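(* For any $n\ge3$, the transformations $R_{1,2},R_{2,3},\dots,R_{n-1,n}$ of the coordinates $(Z_1,\dots,Z_n,Y_2,\dots,Y_{n-2})\in\mathbb R^{2n-3}$ satisfy the braid group relation $$R_{i-1,i}R_{i,i+1}R_{i-1,i}=R_{i,i+1}R_{i-1,i}R_{i,i+1},\qquad 2\le i\le n-1.$$
   Context: The coordinates are the shear coordinates for the disc with $n$ marked points, for the tree-like spine with pending edges $Z_1,\dots,Z_n$ and inner edges $Y_2,\dots,Y_{n-2}$. One identifies $Y_1\equiv Z_1$ and $Y_{n-1}\equiv Z_n$. The transformations are given below; coordinates not listed are unchanged. For $2\le i\le n-2$, $R_{i,i+1}$ maps $$e^{Y_{i-1}}\mapsto e^{Y_{i-1}}\bigl(1+e^{2Z_i}(1+e^{Y_i})\bigr),\qquad e^{Y_i}\mapsto e^{Y_i}\bigl(1+e^{2Z_i}(1+e^{Y_i})^2\bigr)^{-1},$$ $$e^{Y_{i+1}}\mapsto e^{Y_{i+1}}\,\frac{1+e^{2Z_i}(1+e^{Y_i})^2}{1+e^{2Z_i}(1+e^{Y_i})},$$ $$e^{Z_i}\mapsto e^{2Z_i+Z_{i+1}+Y_i}\bigl(1+e^{2Z_i}(1+e^{Y_i})\bigr)^{-1},\qquad e^{Z_{i+1}}\mapsto e^{-Z_i-Y_i}\bigl(1+e^{2Z_i}(1+e^{Y_i})\bigr).$$ $R_{1,2}$ maps $$e^{Z_1}\mapsto e^{Z_2}(1+e^{-2Z_1})^{-1},\qquad e^{Z_2}\mapsto e^{-Z_1},\qquad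 e^{Y_2}\mapsto e^{Y_2}(1+e^{2Z_1}).$$ $R_{n-1,n}$ maps $$e^{Z_{n-1}}\mapsto e^{Z_n}(1+e^{-2Z_{n-1}})^{-1},\qquad e^{Z_n}\mapsto e^{-Z_{n-1}},\qquad e^{Y_{n-2}}\mapsto e^{Y_{n-2}}(1+e^{2Z_{n-1}}).$$ *)

(* Defs.v *)
From mathcomp Require Import all_boot all_order all_algebra.
From mathcomp Require Import all_classical all_reals all_analysis.

Set Implicit Arguments.
Unset Strict Implicit.
Unset Printing Implicit Defensive.

Import Order.TTheory GRing.Theory Num.Theory.
Local Open Scope ring_scope.

(* Edges of the tree-like spine of the disc with n marked points; indices are
   1-based: Zc k is the pending edge Z_k (1 <= k <= n) and Yc j is Y_j
   (1 <= j <= n-1), where Y_1 and Y_(n-1) are the pending edges Z_1 and Z_n. *)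
Inductive spine_edge := Zc of nat | Yc of nat.

(* 0-based position of a coordinate in (Z_1, ..., Z_n, Y_2, ..., Y_(n-2)).
   The identifications Y_1 = Z_1 and Y_(n-1) = Z_n are made here; for n = 3
   there are no inner edges and Y_1, Y_2 are Z_1, Z_3. *)
Definition edge_pos (n : nat) (e : spine_edge) : nat :=
  match e with
  | Zc k => k - 1
  | Yc j => if j == 1 then 0 else if j == n - 1 then n - 1 else n + j - 2
  end%N.

(* The default 0 only concerns edges outside the index ranges above. *)
Definition shear (R : realType) (n : nat) (x : 'rV[R]_(2 * n - 3)) (e : spine_edge) : R :=
  oapp (x 0) 0 (insub (edge_pos n e)).

(* Simultaneous substitution: a pair (e, v) of s stands for exp(e) |-> v, that
   is, the coordinate e becomes ln v; coordinates not listed are unchanged. *)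
Definition exp_subst (R : realType) (n : nat) (x : 'rV[R]_(2 * n - 3))
    (s : seq (spine_edge * R)) : 'rV[R]_(2 * n - 3) :=
  \row_(k < 2 * n - 3)
    foldr (fun p d => if edge_pos n p.1 == k then ln p.2 else d) (x 0 k) s.

Definition braid_inner (R : realType) (n i : nat) (x : 'rV[R]_(2 * n - 3)) :
    'rV[R]_(2 * n - 3) :=
  let z k := shear x (Zc k) in
  let y j := shear x (Yc j) in
  let A := 1 + expR (2 * z i) * (1 + expR (y i)) in
  let B := 1 + expR (2 * z i) * (1 + expR (y i)) ^+ 2 in
  exp_subst x
    [:: (Yc i.-1, expR (y i.-1) * A);
        (Yc i,    expR (y i) * B^-1);
        (Yc i.+1, expR (y i.+1) * (B / A));
        (Zc i,    expR (2 * z i + z i.+1 + y i) * A^-1);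
        (Zc i.+1, expR (- z i - y i) * A)].

Definition braid_first (R : realType) (n : nat) (x : 'rV[R]_(2 * n - 3)) :
    'rV[R]_(2 * n - 3) :=
  let z k := shear x (Zc k) in
  let y j := shear x (Yc j) in
  exp_subst x
    [:: (Zc 1, expR (z 2%N) * (1 + expR (- 2 * z 1%N))^-1);
        (Zc 2, expR (- z 1%N));
        (Yc 2, expR (y 2%N) * (1 + expR (2 * z 1%N)))].

Definition braid_last (R : realType) (n : nat) (x : 'rV[R]_(2 * n - 3)) :
    'rV[R]_(2 * n - 3) :=
  let z k := shear x (Zc k) in
  let y j := shear x (Yc j) in
  exp_subst x
    [:: (Zc n.-1, expR (z n) * (1 + expR (- 2 * z n.-1))^-1);
        (Zc n,    expR (- z n.-1));
        (Yc n.-2, expR (y n.-2) * (1 + expR (2 * z n.-1)))].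

(* R_(i,i+1), meaningful for n >= 3 and 1 <= i <= n-1. *)
Definition braid (R : realType) (n i : nat) : 'rV[R]_(2 * n - 3) -> 'rV[R]_(2 * n - 3) :=
  if i == 1%N then @braid_first R n
  else if i == n.-1 then @braid_last R n
  else @braid_inner R n i.

(* Main.v *)
Require Import Defs.
From mathcomp Require Import all_boot all_order all_algebra.
From mathcomp Require Import all_classical all_reals all_analysis.
From mathcomp Require Import ring zify.

Set Implicit Arguments.
Unset Strict Implicit.
Unset Printing Implicit Defensive.

Import Order.TTheory GRing.Theory Num.Theory.
Local Open Scope ring_scope.

(** In the exponentials of the shear coordinates each generator is a rational
    map without subtractions, so it preserves positivity and no denominator
    ever vanishes; as the exponential is injective, it suffices to prove the
    relations for these rational maps ([braid_relation_transfer]).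

    A generator reads and changes at most five coordinates, and two
    consecutive generators involve at most seven.  Hence each relation is an
    identity between rational maps of at most seven variables, and the size of
    the disc matters only through the edges that are pending: the two
    generators can both be inner, or one or both of them can be an end move.
    This gives the relations [braid_inner_inner], [braid_end_inner],
    [braid_inner_end] and [braid_end_end].  Both end generators are the same
    map [end_move] with different edges, and the identifications Y_1 = Z_1 and
    Y_(n-1) = Z_n become coincidences between the keys of the two moves.

    In each relation both words are equal to one explicit map.  Its closed form
    is short because the denominators that accumulate factor.  For two inner
    moves, put (with exponentials written z_i, y_i)
      v0 = (1, z1),  v1 = (1, z1 (1 + y1)),  v2 = v0 + y2 v1,
    so that the polynomials of the first move are A = <v0,v1> and B = <v1,v1>.
    As det(v0,v1) = z1 y1, the Lagrange identity reads
      A^2 + (z1 y1)^2 = (1 + z1^2) B.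
    It makes B a factor of both polynomials of the second move, which become
      B <v0,v2> / (z1 y1)^2  and  B <v2,v2> / (z1 y1)^2,
    and B then cancels from the new coordinates. *)

(** * Rational moves on families of positive numbers *)

Definition update (T : Type) (X : nat -> T) (s : seq (nat * T)) : nat -> T :=
  fun k => foldr (fun p d => if p.1 == k then p.2 else d) (X k) s.

Definition assign (T : Type) (X : nat -> T) (ks : seq nat) (vs : seq T) :
    nat -> T :=
  update X (zip ks vs).

Lemma assign_self (T : Type) (X : nat -> T) (ks : seq nat) :
  assign X ks [seq X k | k <- ks] = X.
Proof.
apply/funext => k; rewrite /assign /update.
by elim: ks => //= a ks ->; case: eqP => // ->.
Qed.

Section Moves.
Context {R : realType}.
Implicit Type X : nat -> R.

Definition inner_move (p0 p1 p2 q1 q2 : nat) X : nat -> R :=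
  let A := 1 + X q1 ^+ 2 * (1 + X p1) in
  let B := 1 + X q1 ^+ 2 * (1 + X p1) ^+ 2 in
  update X
    [:: (p0, X p0 * A); (p1, X p1 * B^-1); (p2, X p2 * (B / A));
        (q1, X q1 ^+ 2 * X q2 * X p1 * A^-1); (q2, (X q1)^-1 / X p1 * A)].

Definition end_move (q1 q2 p : nat) X : nat -> R :=
  update X
    [:: (q1, X q2 * (1 + (X q1 ^+ 2)^-1)^-1); (q2, (X q1)^-1);
        (p, X p * (1 + X q1 ^+ 2))].

End Moves.

(** One move on a family given by explicit values on the keys that the
    hypothesis [U : uniq _] lists: [U] decides every comparison of keys, after
    which the two families are compared key by key. *)
Ltac run_move U :=
  move: (U); rewrite /= !inE !negb_or -!andbA;
  do ! (case/andP => ?); move=> _;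
  rewrite /end_move /inner_move /assign /update /=;
  let decide_keys := repeat match goal with
    | |- context [?a == ?a] => rewrite (eqxx a)
    | H : is_true (?a != ?b) |- context [?a == ?b] => rewrite (negPf H)
    | H : is_true (?a != ?b) |- context [?b == ?a] =>
        rewrite (eq_sym b a) (negPf H)
    end in
  decide_keys; cbn iota;
  let k := fresh "k" in
  apply/funext => k /=;
  repeat match goal with
  | |- context [?a == k] =>
      case: (a =P k) => [? | _]; [subst k; by decide_keys |]
  end; by [].

Ltac positive :=
  repeat first [ assumption | apply: ltr01 | apply: mulr_gt0
               | apply: addr_gt0 | apply: exprn_gt0 | apply: expR_gt0
               | rewrite invr_gt0 ].

(** For subtraction-free rational identities in positive quantities: the
    denominators are then sums of products of positive quantities, so none of
    them vanishes. *)
Ltac positive_field :=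
  field; do ? [apply/andP; split]; apply: lt0r_neq0; positive.

(** * The four local braid relations *)

Section LocalBraid.
Context {R : realType}.
Variable X : nat -> R.
Hypothesis X_gt0 : forall k, 0 < X k.

(** In the closed form C = <v0,v2> and D = <v2,v2> for the vectors
    v0 = (1, z1), v1 = (1, z1 (1 + y1)), v2 = v0 + y2 v1.  With A = <v0,v1>, the
    two polynomials of the third move of the word L (H (L X)) are E / A and Q;
    the word H (L (H X)) meets them earlier: Q is a polynomial of its first
    move, and E of its second. *)
Lemma braid_inner_inner (p0 p1 p2 p3 q1 q2 q3 : nat) :
    uniq [:: p0; p1; p2; p3; q1; q2; q3] ->
  let L := inner_move p0 p1 p2 q1 q2 in
  let H := inner_move p1 p2 p3 q2 q3 in
  L (H (L X)) = H (L (H X)).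
Proof.
set ks := (ks in uniq ks) => U.
have lowE a0 a1 a2 a3 b1 b2 b3 :
    let A := 1 + b1 ^+ 2 * (1 + a1) in
    let B := 1 + b1 ^+ 2 * (1 + a1) ^+ 2 in
  inner_move p0 p1 p2 q1 q2 (assign X ks [:: a0; a1; a2; a3; b1; b2; b3]) =
  assign X ks [:: a0 * A; a1 / B; a2 * (B / A); a3;
                  b1 ^+ 2 * b2 * a1 / A; b1^-1 / a1 * A; b3].
  by run_move U.
have highE a0 a1 a2 a3 b1 b2 b3 :
    let A := 1 + b2 ^+ 2 * (1 + a2) in
    let B := 1 + b2 ^+ 2 * (1 + a2) ^+ 2 in
  inner_move p1 p2 p3 q2 q3 (assign X ks [:: a0; a1; a2; a3; b1; b2; b3]) =
  assign X ks [:: a0; a1 * A; a2 / B; a3 * (B / A);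
                  b1; b2 ^+ 2 * b3 * a2 / A; b2^-1 / a2 * A].
  by run_move U.
move=> /=; rewrite -[X](assign_self X ks) /=.
have := (X_gt0 p0, X_gt0 p1, X_gt0 p2, X_gt0 p3, X_gt0 q1, X_gt0 q2, X_gt0 q3).
move: (X p0) (X p1) (X p2) (X p3) (X q1) (X q2) (X q3).
move=> y0 y1 y2 y3 z1 z2 z3 [[[[[[? ?] ?] ?] ?] ?] ?].
pose C := 1 + y2 + z1 ^+ 2 * (1 + y2 + y1 * y2).
pose D := (1 + y2) ^+ 2 + z1 ^+ 2 * (1 + y2 + y1 * y2) ^+ 2.
pose Q := 1 + z2 ^+ 2 * (1 + y2) ^+ 2.
pose E := 1 + z1 ^+ 2 * (1 + y1 * (1 + z2 ^+ 2 * (1 + y2))).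
transitivity (assign X ks
  [:: y0 * E; C / (z1 ^+ 2 * y1 * Q); z1 ^+ 2 * y1 ^+ 2 * y2 * Q / (D * E);
      y3 * D / C; z1 ^+ 2 * z2 ^+ 2 * z3 * y1 * y2 / E; E / (z2 * C);
      C / (z1 * y1 * y2)]); rewrite !(lowE, highE) /= /C /D /Q /E;
  congr (assign _ _ [:: _; _; _; _; _; _; _]);
  positive_field.
Qed.

(** Here Y_1 is the pending edge Z_1, so [q1] is also the first key of the inner
    move.  After L, the two polynomials of H are (1 + z1^2) (1 + y2) / z1^2 and
    (1 + z1^2) D / z1^2, and the factor 1 + z1^2 cancels against the one that L
    has created in the coordinates at [p2] and [q1]. *)
Lemma braid_end_inner (p2 p3 q1 q2 q3 : nat) :
    uniq [:: p2; p3; q1; q2; q3] ->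
  let L := end_move q1 q2 p2 in
  let H := inner_move q1 p2 p3 q2 q3 in
  L (H (L X)) = H (L (H X)).
Proof.
set ks := (ks in uniq ks) => U.
have lowE a2 a3 b1 b2 b3 :
  end_move q1 q2 p2 (assign X ks [:: a2; a3; b1; b2; b3]) =
  assign X ks [:: a2 * (1 + b1 ^+ 2); a3;
                  b2 * (1 + (b1 ^+ 2)^-1)^-1; b1^-1; b3].
  by run_move U.
have highE a2 a3 b1 b2 b3 :
    let A := 1 + b2 ^+ 2 * (1 + a2) in
    let B := 1 + b2 ^+ 2 * (1 + a2) ^+ 2 in
  inner_move q1 p2 p3 q2 q3 (assign X ks [:: a2; a3; b1; b2; b3]) =
  assign X ks [:: a2 / B; a3 * (B / A);
                  b1 * A; b2 ^+ 2 * b3 * a2 / A; b2^-1 / a2 * A].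
  by run_move U.
move=> /=; rewrite -[X](assign_self X ks) /=.
have := (X_gt0 p2, X_gt0 p3, X_gt0 q1, X_gt0 q2, X_gt0 q3).
move: (X p2) (X p3) (X q1) (X q2) (X q3).
move=> y2 y3 z1 z2 z3 [[[[? ?] ?] ?] ?].
pose D := (1 + y2) ^+ 2 + z1 ^+ 2 * y2 ^+ 2.
pose Q := 1 + z2 ^+ 2 * (1 + y2) ^+ 2.
transitivity (assign X ks
  [:: z1 ^+ 2 * y2 * Q / D; y3 * D / (1 + y2);
      z2 ^+ 2 * z3 * y2 * (1 + y2) / Q; (z2 * (1 + y2))^-1;
      (1 + y2) / (z1 * y2)]); rewrite !(lowE, highE) /= /D /Q;
  congr (assign _ _ [:: _; _; _; _; _]);
  positive_field.
Qed.

(** Here Y_(n-1) is the pending edge Z_n, so [q3] is also the last Y-key of the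
    inner move.  After H, the polynomials of L are E and
    B = 1 + z1^2 (1 + y2 P)^2, and the Lagrange identity
    E^2 + (z1 y2 P)^2 = (1 + z1^2) B removes B in the second H. *)
Lemma braid_inner_end (p1 p2 q1 q2 q3 : nat) :
    uniq [:: p1; p2; q1; q2; q3] ->
  let L := inner_move p1 p2 q3 q1 q2 in
  let H := end_move q2 q3 p2 in
  L (H (L X)) = H (L (H X)).
Proof.
set ks := (ks in uniq ks) => U.
have lowE a1 a2 b1 b2 b3 :
    let A := 1 + b1 ^+ 2 * (1 + a2) in
    let B := 1 + b1 ^+ 2 * (1 + a2) ^+ 2 in
  inner_move p1 p2 q3 q1 q2 (assign X ks [:: a1; a2; b1; b2; b3]) =
  assign X ks [:: a1 * A; a2 / B;
                  b1 ^+ 2 * b2 * a2 / A; b1^-1 / a2 * A; b3 * (B / A)].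
  by run_move U.
have highE a1 a2 b1 b2 b3 :
  end_move q2 q3 p2 (assign X ks [:: a1; a2; b1; b2; b3]) =
  assign X ks [:: a1; a2 * (1 + b2 ^+ 2);
                  b1; b3 * (1 + (b2 ^+ 2)^-1)^-1; b2^-1].
  by run_move U.
move=> /=; rewrite -[X](assign_self X ks) /=.
have := (X_gt0 p1, X_gt0 p2, X_gt0 q1, X_gt0 q2, X_gt0 q3).
move: (X p1) (X p2) (X q1) (X q2) (X q3).
move=> y1 y2 z1 z2 z3 [[[[? ?] ?] ?] ?].
pose P := 1 + z2 ^+ 2.
pose E := 1 + z1 ^+ 2 * (1 + y2 * P).
transitivity (assign X ks
  [:: y1 * E; (1 + z1 ^+ 2) / (z1 ^+ 2 * y2 * P);
      z1 ^+ 2 * z2 ^+ 2 * z3 * y2 / E; E / (z2 * (1 + z1 ^+ 2));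
      z1 * y2 * P / E]); rewrite !(lowE, highE) /= /E /P;
  congr (assign _ _ [:: _; _; _; _; _]);
  positive_field.
Qed.

(** The disc with three marked points: L followed by H is the rotation
    (z1, z2, z3) |-> (z2, z3, z1), which carries H to L because the keys of H
    are those of L shifted by one. *)
Lemma braid_end_end (q1 q2 q3 : nat) :
    uniq [:: q1; q2; q3] ->
  let L := end_move q1 q2 q3 in
  let H := end_move q2 q3 q1 in
  L (H (L X)) = H (L (H X)).
Proof.
set ks := (ks in uniq ks) => U.
have lowE b1 b2 b3 :
  end_move q1 q2 q3 (assign X ks [:: b1; b2; b3]) =
  assign X ks [:: b2 * (1 + (b1 ^+ 2)^-1)^-1; b1^-1; b3 * (1 + b1 ^+ 2)].
  by run_move U.
have highE b1 b2 b3 :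
  end_move q2 q3 q1 (assign X ks [:: b1; b2; b3]) =
  assign X ks [:: b1 * (1 + b2 ^+ 2); b3 * (1 + (b2 ^+ 2)^-1)^-1; b2^-1].
  by run_move U.
move=> /=; rewrite -[X](assign_self X ks) /=.
have := (X_gt0 q1, X_gt0 q2, X_gt0 q3).
move: (X q1) (X q2) (X q3) => z1 z2 z3 [[? ?] ?].
transitivity (assign X ks
  [:: z2 ^+ 2 * z3 / (1 + z2 ^+ 2); z2^-1; z1 * (1 + z2 ^+ 2)]);
  rewrite !(lowE, highE) /=; congr (assign _ _ [:: _; _; _]); positive_field.
Qed.

End LocalBraid.

(** * Exponentiated shear coordinates *)

Section ExpCoord.
Context {R : realType} {n : nat}.
Hypothesis hn : (3 <= n)%N.
Implicit Type x : 'rV[R]_(2 * n - 3).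

(** Indexed by all of nat, as the rational moves are; the value 1 past the
    last coordinate keeps every entry positive. *)
Definition exp_coord x (k : nat) : R := expR (oapp (x 0) 0 (insub k)).

Lemma exp_coord_gt0 x k : 0 < exp_coord x k.
Proof. exact: expR_gt0. Qed.

Lemma exp_coord_inj : injective exp_coord.
Proof.
move=> x x' eq_xx'; apply/rowP => j.
have := congr1 (@^~ (val j)) eq_xx'.
by rewrite /exp_coord /= valK => /expR_inj.
Qed.

Lemma expR_shear x e : expR (shear x e) = exp_coord x (edge_pos n e).
Proof. by []. Qed.

(** A substitution at a position past the end would change the right-hand side
    but not the vector, and [ln] only inverts [expR] on positive values: hence
    the two conditions. *)
Lemma exp_coord_subst x (s : seq (spine_edge * R)) :
    all (fun p => (edge_pos n p.1 < 2 * n - 3)%N && (0 < p.2)) s ->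
  exp_coord (exp_subst x s) =
  update (exp_coord x) [seq (edge_pos n p.1, p.2) | p <- s].
Proof.
move=> s_ok; apply/funext => k; rewrite /exp_coord /update.
case: insubP => [j _ <- | ge_k] /=.
  rewrite mxE.
  elim: s s_ok => //= -[e v] s IHs /= /andP[/andP[_ v_gt0] /IHs <-].
  by case: eqP => // _; rewrite lnK // posrE.
elim: s s_ok => //= -[e v] s IHs /= /andP[/andP[lt_e _] /IHs <-].
by case: eqP lt_e ge_k => // -> ->.
Qed.

Lemma edge_pos_lt e :
  match e with Zc k => (k <= n)%N | Yc j => (j < n)%N end ->
  (edge_pos n e < 2 * n - 3)%N.
Proof.
by case: e => [k | j] /=; [| case: ifP => ?; [| case: ifP => ?]]; lia.
Qed.

(** Z_1 and Z_n are excluded among the Z edges because they are counted as Y_1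
    and Y_(n-1); with this convention every edge of the spine has one name. *)
Lemma edge_pos_neq e e' :
    match e with Zc k => (1 < k < n)%N | Yc j => (0 < j < n)%N end ->
    match e' with Zc k => (1 < k < n)%N | Yc j => (0 < j < n)%N end ->
  e <> e' -> edge_pos n e != edge_pos n e'.
Proof.
move=> e_ok e'_ok neq_ee'; apply/eqP => eq_pos; apply: neq_ee'.
move: e_ok e'_ok eq_pos.
by case: e e' => [k | j] [k' | j'] /=; do ? (case: ifP => ?); move=> *;
  (congr Zc + congr Yc + exfalso); lia.
Qed.

Ltac valid_subst :=
  do ? [apply/andP; split];
  first [done | by apply: edge_pos_lt => /=; lia | by move=> /=; positive].

Lemma exp_coord_first x :
  exp_coord (braid 1 x) =
  end_move (edge_pos n (Zc 1)) (edge_pos n (Zc 2)) (edge_pos n (Yc 2))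
    (exp_coord x).
Proof.
rewrite /braid /= exp_coord_subst; last by valid_subst.
by rewrite mulNr !expRN !expRM_natl !expR_shear.
Qed.

Lemma exp_coord_last x :
  exp_coord (braid n.-1 x) =
  end_move (edge_pos n (Zc n.-1)) (edge_pos n (Zc n)) (edge_pos n (Yc n.-2))
    (exp_coord x).
Proof.
have last_neq1 : (n.-1 == 1)%N = false by lia.
rewrite /braid last_neq1 eqxx exp_coord_subst; last by valid_subst.
by rewrite mulNr !expRN !expRM_natl !expR_shear.
Qed.

Lemma exp_coord_inner i x : (2 <= i <= n - 2)%N ->
  exp_coord (braid i x) =
  inner_move (edge_pos n (Yc i.-1)) (edge_pos n (Yc i)) (edge_pos n (Yc i.+1))
    (edge_pos n (Zc i)) (edge_pos n (Zc i.+1)) (exp_coord x).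
Proof.
move=> hi.
have [neq1 neq_last] : (i == 1)%N = false /\ (i == n.-1) = false by lia.
rewrite /braid neq1 neq_last exp_coord_subst; last by valid_subst.
by rewrite !expRD !expRN !expRM_natl !expR_shear.
Qed.

Lemma braid_relation_transfer f g F G :
    (forall x, exp_coord (f x) = F (exp_coord x)) ->
    (forall x, exp_coord (g x) = G (exp_coord x)) ->
    (forall X : nat -> R, (forall k, 0 < X k) -> F (G (F X)) = G (F (G X))) ->
  f \o g \o f =1 g \o f \o g.
Proof.
move=> fE gE FG x; apply: exp_coord_inj => /=.
by rewrite !(fE, gE) FG //; apply: exp_coord_gt0.
Qed.

End ExpCoord.

(** * The braid relations *)

Ltac distinct_positions :=
  rewrite !cons_uniq !inE !negb_or; do ? [apply/andP; split]; rewrite //;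
  (apply: edge_pos_neq => /=;
    [lia | lia | lia | first [discriminate | case; lia]]).

Theorem lemma5 (R : realType) (n : nat) (hn : (3 <= n)%N)
    (i : nat) (hi : (2 <= i <= n - 1)%N) :
  (@braid R n i.-1 \o @braid R n i \o @braid R n i.-1)
  =1 (@braid R n i \o @braid R n i.-1 \o @braid R n i).
Proof.
have Y1 : edge_pos n (Yc 1) = edge_pos n (Zc 1) by [].
have Yn : edge_pos n (Yc n.-1) = edge_pos n (Zc n).
  by rewrite /= subn1 eqxx; case: ifP; lia.
have [i2 | i_neq2] := eqVneq i 2%N; have [i_n | i_neqn] := eqVneq i n.-1.
- have n3 : n = 3%N by lia.
  subst n i.
  apply: (braid_relation_transfer (exp_coord_first hn) (exp_coord_last hn)).
  by move=> X X_gt0; apply: braid_end_end.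
- subst i; have inner2 : (2 <= 2 <= n - 2)%N by lia.
  apply: (braid_relation_transfer (exp_coord_first hn)
            (fun x => exp_coord_inner hn x inner2)) => X X_gt0.
  rewrite -Y1; apply: braid_end_inner => //.
  distinct_positions.
- subst i; have inner_n : (2 <= n.-2 <= n - 2)%N by lia.
  apply: (braid_relation_transfer (fun x => exp_coord_inner hn x inner_n)
            (exp_coord_last hn)) => X X_gt0.
  have -> : (n.-2).+1 = n.-1 by lia.
  rewrite -Yn; apply: braid_inner_end => //.
  distinct_positions.
- have inner_i : (2 <= i <= n - 2)%N by lia.
  have inner_i1 : (2 <= i.-1 <= n - 2)%N by lia.
  apply: (braid_relation_transfer (fun x => exp_coord_inner hn x inner_i1)
            (fun x => exp_coord_inner hn x inner_i)) => X X_gt0.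
  rewrite (@ltn_predK 1 i); last lia.
  apply: braid_inner_inner => //.
  distinct_positions.
Qed.
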